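(* Let $P$ be a finite set of plans and $V$ a finite set of vehicles, with travel time function $f_{\mathrm{tt}}$ and travel cost function $f_{\mathrm{tc}}$, such that any two plan chains that differ only in the delays of their plan variants have equal cost. Let $\Phi^{\mathrm{alg}}$ be the set of delayed plan variants generated by the variant generation algorithm (described in the context) on input $(P,V)$. Then there exists an optimal solution $C$ of the plan chaining problem for $(P,V)$ such that every element, other than the first (the vehicle), of every chain $c\in C$ belongs to $P\cup\Phi^{\mathrm{alg}}$; that is, $C$ contains only non-delayed plans and plan variants generated by the algorithm.
   Context: **Plans, vehicles, variants.** Each plan $p\in P$ has an origin time $t^{\mathrm{o}}_p\in\mathbb{R}$, a destination time $t^{\mathrm{d}}_p\in\mathbb{R}$ and a maximum delay $\delta^{\max}_p\ge 0$. Each vehicle $v\in V$ has a start time $t^{\mathrm{s}}_v\in\mathbb{R}$. A delayed variant $p'$ of $p$ is determined by a delay $0\le\delta_{p'}\le\delta^{\max}_p$, and has $t^{\mathrm{o}}_{p'}=t^{\mathrm{o}}_p+\delta_{p'}$ and $t^{\mathrm{d}}_{p'}=t^{\mathrm{d}}_p+\delta_{p'}$. The plan $p$ itself is identified with its variant of delay $0$. $\Phi_p$ denotes the set of all variants of $p$ (including $p$ itself), and $\Phi=\bigcup_{p\in P}\Phi_p$ (variants of different plans are regarded as distinct). **Travel time and cost.** Functions $f_{\mathrm{tt}}(a,b)$ (travel time from $a$ to $b$) and $f_{\mathrm{tc}}(a,b)$ (travel cost from $a$ to $b$) are given for $a,b\in P\cup V$; they need not be symmetric. The value at a delayed variant is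 the value at the underlying non-delayed plan (travel times and connection costs do not depend on time), so plan chains differing only in the delays of their plan variants have equal costs. **Plan chain.** A plan chain is a finite sequence $c=(c_1,\dots,c_{|c|})$ with $c_1\in V$, $c_i\in P\cup\Phi$ for $i\ge 2$, $t^{\mathrm{s}}_{c_1}+f_{\mathrm{tt}}(c_1,c_2)\le t^{\mathrm{o}}_{c_2}$ (if $|c|\ge2$), and $t^{\mathrm{d}}_{c_{i-1}}+f_{\mathrm{tt}}(c_{i-1},c_i)\le t^{\mathrm{o}}_{c_i}$ for all $3\le i\le |c|$. The cost of $c$ is $\sum_{i=2}^{|c|} f_{\mathrm{tc}}(c_{i-1},c_i)$. **Plan chaining problem.** Given $P$ and $V$, find a set $C$ of plan chains minimizing $\sum_{c\in C}\sum_{i=2}^{|c|} f_{\mathrm{tc}}(c_{i-1},c_i)$ subject to: for every $p\in P$ there is exactly one pair $(c,i)$ with $c\in C$, $2\le i\le|c|$, $c_i\in\Phi_p$ (exactly one variant of each plan is contained in exactly one chain), and for every $v\in V$ at most one $c\in C$ has $c_1=v$. A minimizer is called an optimal solution. **Variant generation algorithm.** Start with $\Phi^{\mathrm{alg}}=\emptyset$, a set of connections $X=\emptyset$ and an empty queue. The procedure $\mathtt{try\_connect}(a,b)$, for $a$ a plan, variant, or vehicle and $b\in P$, computes $$m = f_{\mathrm{tt}}(a,b)-(t^{\mathrm{o}}_b-t^{\mathrm{d}}_a)\ \text{ if } a \text{ is a plan or variant},\qquad m=f_{\mathrm{tt}}(a,b)-(t^{\mathrm{o}}_b-t^{\mathrm{s}}_a)\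 \text{ if } a\in V.$$ If $m\le 0$, it adds the pair $(a,b)$ to $X$. Otherwise, if $0<m\le\delta^{\max}_b$, it lets $\phi$ be the variant of $b$ with delay $m$, adds $(a,\phi)$ to $X$, adds $\phi$ to $\Phi^{\mathrm{alg}}$, and pushes $\phi$ on the queue. Otherwise it does nothing. The algorithm first calls $\mathtt{try\_connect}(a,b)$ for all $a\in P\cup V$ and all $b\in P\setminus\{a\}$. Then, while the queue is nonempty, it pops a variant $\phi$ and calls $\mathtt{try\_connect}(\phi,p)$ for every $p\in P$ such that $\phi$ is not a delayed variant of $p$. $\Phi^{\mathrm{alg}}$ is the set of all variants that are ever added in this process.
   Formalization: The plan chaining problem for (P,V) is assumed to have at least one feasible solution; without this (e.g. no vehicles and one plan) no optimal solution exists and the claim fails. *)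

(* Defs.v *)
From mathcomp Require Import all_boot all_order all_algebra.
From mathcomp Require Import all_classical all_reals.

Set Implicit Arguments.
Unset Strict Implicit.
Unset Printing Implicit Defensive.
Import Order.TTheory GRing.Theory Num.Theory.
Local Open Scope classical_set_scope.
Local Open Scope ring_scope.

Record instance (R : realType) (P V : finType) := Instance {
  torig : P -> R;
  tdest : P -> R;
  max_delay : P -> R;
  max_delay_ge0 : forall p, 0 <= max_delay p;
  tstart : V -> R;
  travel_time : P + V -> P + V -> R;
  travel_cost : P + V -> P + V -> R
}.

Section PlanChaining.
Variables (R : realType) (P V : finType) (I : instance R P V).

(* A pair (p, d) stands for the variant of p with delay d, and (p, 0) for p
   itself; the bounds on d are imposed by [variants_of]. *)
Definition variant : Type := (P * R)%type.

Definition variants_of (p : P) : set variant :=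
  [set x | x.1 = p /\ 0 <= x.2 <= max_delay I p].

Definition all_variants : set variant := \bigcup_p variants_of p.

Definition nondelayed : set variant := [set x | x.2 = 0].

Definition vorig (x : variant) : R := torig I x.1 + x.2.
Definition vdest (x : variant) : R := tdest I x.1 + x.2.

Definition element : Type := (variant + V)%type.

Definition node (a : element) : P + V :=
  match a with inl x => inl x.1 | inr v => inr v end.

Definition node_element (a : P + V) : element :=
  match a with inl p => inl (p, 0) | inr v => inr v end.

Definition free_time (a : element) : R :=
  match a with inl x => vdest x | inr v => tstart I v end.

Definition ftt (a : element) (x : variant) : R :=
  travel_time I (node a) (inl x.1).
Definition ftc (a : element) (x : variant) : R :=
  travel_cost I (node a) (inl x.1).

(* The sequence (c_1, ..., c_n) is represented by c_1 and (c_2, ..., c_n). *)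
Definition sequence : Type := (V * seq variant)%type.

(* The consecutive pairs (c_(i-1), c_i); [zip] drops the last element of its
   longer first argument. *)
Definition connections (c : sequence) : seq (element * variant) :=
  zip (inr c.1 :: map inl c.2) c.2.

Definition plan_chain (c : sequence) : Prop :=
  (forall x, x \in c.2 -> all_variants x) /\
  (forall e, e \in connections c ->
     free_time e.1 + ftt e.1 e.2 <= vorig e.2).

Definition chain_cost (c : sequence) : R :=
  \sum_(e <- connections c) ftc e.1 e.2.

Definition same_up_to_delays (c c' : sequence) : Prop :=
  c.1 = c'.1 /\ map fst c.2 = map fst c'.2.

Definition variant_at (p : P) (c : sequence) (i : nat) : Prop :=
  exists2 x, onth c.2 i = Some x & variants_of p x.

Definition feasible (C : set sequence) : Prop :=
  [/\ forall c, C c -> plan_chain c,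
      forall p, exists! ci : sequence * nat,
        C ci.1 /\ variant_at p ci.1 ci.2 &
      forall v c c', C c -> C c' -> c.1 = v -> c'.1 = v -> c = c'].

(* A feasible C is finite, having at most one chain per vehicle, so this sum
   over a set of finite support is the ordinary finite sum. *)
Definition total_cost (C : set sequence) : R := \sum_(c \in C) chain_cost c.

Definition optimal (C : set sequence) : Prop :=
  feasible C /\ forall C', feasible C' -> total_cost C <= total_cost C'.

Record state := State {
  generated : set variant;
  links : set (element * variant);
  queue : seq variant
}.

Definition try_connect (s : state) (ab : element * P) : state :=
  let: (a, b) := ab in
  let m := travel_time I (node a) (inl b) - (torig I b - free_time a) in
  if m <= 0 then
    State (generated s) (links s `|` [set (a, (b, 0))]) (queue s)
  else if m <= max_delay I b then
    State (generated s `|` [set (b, m)]) (links s `|` [set (a, (b, m))])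
      (rcons (queue s) (b, m))
  else s.

Definition initial_calls : seq (element * P) :=
  [seq (node_element a, b) | a <- enum {: P + V},
                             b <- [seq b <- enum P | inl b != a]].

Definition initial_state : state :=
  foldl try_connect (State set0 set0 [::]) initial_calls.

Definition pop_step (s : state) : state :=
  if queue s is x :: q then
    foldl try_connect (State (generated s) (links s) q)
      [seq (inl x, p) | p <- enum P & x.1 != p]
  else s.

(* The queue may never empty (connection cycles of total slack zero); the union
   over all iterations collects every variant ever added in either case. *)
Definition alg_variants : set variant :=
  \bigcup_n generated (iter n pop_step initial_state).

End PlanChaining.

(* Main.v *)
Require Import Defs.
From mathcomp Require Import all_boot all_order all_algebra.
From mathcomp Require Import all_classical all_reals.
From mathcomp Require Import lra.
Import Order.TTheory GRing.Theory Num.Theory.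
Local Open Scope classical_set_scope.
Local Open Scope ring_scope.

(** Costs do not depend on delays, and a feasible solution uses each plan once,
    so up to delays there are finitely many feasible solutions and an optimal
    one exists.  Rescheduling each of its chains greedily, every plan being
    served as early as its predecessor allows, never increases a delay, hence
    keeps the solution feasible and optimal.  Along a rescheduled chain, a
    positive delay is exactly the one computed by [try_connect] on the
    predecessor, and [try_connect] is eventually called on every generated
    variant because the queue is first-in first-out. *)

(** * Greedy rescheduling of a chain *)

Section Earliest.
Context {R : realType} {P V : finType} (I : instance R P V).
Implicit Types (a : element R P V) (x : variant R P) (c : sequence R P V).

(** The quantity [m] of [try_connect]; it is negative when there is slack. *)
Definition needed_delay a (b : P) : R :=
  travel_time I (node a) (inl b) - (torig I b - free_time I a).

Fixpoint earliest a (s : seq P) : seq (variant R P) :=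
  if s is p :: s' then
    let x := (p, Num.max 0 (needed_delay a p)) in x :: earliest (inl x) s'
  else [::].

Definition reschedule c : sequence R P V :=
  (c.1, earliest (inr c.1) (map fst c.2)).

Lemma map_fst_earliest a s : map fst (earliest a s) = s.
Proof. by elim: s a => //= p s IH a; rewrite IH. Qed.

Lemma reschedule_same c : same_up_to_delays c (reschedule c).
Proof. by split; rewrite //= map_fst_earliest. Qed.

(** Recursive form of [plan_chain] that may start at any element, so that induction along the chain
    applies. *)
Fixpoint chain_from a (s : seq (variant R P)) : Prop :=
  if s is x :: s' then
    [/\ all_variants I x, free_time I a + ftt I a x <= vorig I x &
        chain_from (inl x) s']
  else True.

Lemma plan_chainE c : plan_chain I c <-> chain_from (inr c.1) c.2.
Proof.
case: c => v s; rewrite /plan_chain /connections /=.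
elim: s (inr v : element R P V) => [|x s IH] a /=; first by split.
have {}IH := IH (inl x); split.
- case=> sv sc; split; first by apply: sv; rewrite mem_head.
    by apply: (sc (a, x)); rewrite mem_head.
  by apply/IH; split=> [y ys|e es]; [apply: sv|apply: sc]; rewrite inE ?ys ?es orbT.
- case=> xv ax /IH[sv sc]; split=> [y|e]; rewrite inE.
    by case/predU1P=> [->|/sv].
  by case/predU1P=> [->|/sc].
Qed.

Lemma all_variantsE x : all_variants I x <-> 0 <= x.2 <= max_delay I x.1.
Proof.
by split=> [[p _ [<-]]|] //; exists x.1.
Qed.

(** A predecessor that is free no later needs no larger delay, so each greedy delay is at most the
    given one and stays within its bound. The induction compares the greedy predecessor [a] with the
    given one [a']. *)
Lemma chain_from_earliest a a' s :
  node a = node a' -> free_time I a <= free_time I a' ->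
  chain_from a' s -> chain_from a (earliest a (map fst s)).
Proof.
elim: s a a' => [|[p d] s IH] a a' naa' taa' //= [/all_variantsE/= /andP[d0 dM]].
rewrite /ftt /vorig /= -naa' => tp sc.
have md : Num.max 0 (needed_delay a p) <= d.
  by rewrite ge_max d0 /needed_delay; lra.
split.
- by apply/all_variantsE; rewrite /= le_max lexx (le_trans md).
- have : needed_delay a p <= Num.max 0 (needed_delay a p).
    by rewrite le_max lexx orbT.
  by rewrite /ftt /needed_delay /=; lra.
- by apply: IH sc; rewrite //= /vdest lerD2l.
Qed.

Lemma plan_chain_reschedule c : plan_chain I c -> plan_chain I (reschedule c).
Proof. by move=> /plan_chainE cc; apply/plan_chainE/(chain_from_earliest _ _ _ _ _ cc). Qed.

Lemma variant_at_plan c p i : plan_chain I c ->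
  variant_at I p c i <-> onth (map fst c.2) i = Some p.
Proof.
case=> cv _; rewrite onth_map; split=> [[x -> [<-]]|] //=.
case cx: (onth c.2 i) => [x|] //= [<-]; exists x => //; split=> //.
by apply/all_variantsE/cv/onthP; exists i.
Qed.

End Earliest.

(** * Invariance of the cost and existence of an optimum *)

Section Cost.
Context {R : realType} {P V : finType} (I : instance R P V).
Implicit Types (c : sequence R P V) (C : set (sequence R P V)).

Lemma chain_cost_same c c' :
  same_up_to_delays c c' -> chain_cost I c = chain_cost I c'.
Proof.
case: c c' => v s [w s'] [/= <-]; rewrite /chain_cost /connections /=.
(* Past the first step the predecessors are variants of one plan with possibly different delays, so
   both starts are generalized. *)
suff cost a b : node a = node b -> map fst s = map fst s' ->
    \sum_(e <- zip (a :: map inl s) s) ftc I e.1 e.2 =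
    \sum_(e <- zip (b :: map inl s') s') ftc I e.1 e.2 by exact: cost.
elim: s s' a b => [|x s IH] [|y s'] a b //= nab.
case=> xy ss'; rewrite !big_cons /ftc /= nab xy; congr (_ + _).
by apply: IH; rewrite //= xy.
Qed.

(* [[::]] when [v] is not used in [C]; an empty chain has cost [0]. *)
Definition chain_of C (v : V) : seq (variant R P) := xget [::] [set s | C (v, s)].

Lemma total_cost_vehicles C :
  (forall c c', C c -> C c' -> c.1 = c'.1 -> c = c') ->
  total_cost I C = \sum_v chain_cost I (v, chain_of C v).
Proof.
move=> C1; pose h v : sequence R P V := (v, chain_of C v).
have hC c : C c -> h c.1 = c.
  move=> Cc; have Cs : exists s, C (c.1, s) by exists c.2; case: (c) Cc.
  by apply: C1 => //; exact: (xgetPex [::] Cs).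
have CE : C = h @` (fst @` C).
  apply/seteqP; split=> [c Cc|_ [_ [c Cc <-] <-]]; last by rewrite hC.
  by exists c.1; [exists c|exact: hC].
rewrite /total_cost {1}CE fsbig_image; last by move=> v w _ _ [].
rewrite (fsbig_fwiden (index_enum V)) //=.
- by move=> v _; rewrite /= mem_index_enum.
- exact: index_enum_uniq.
- move=> v [_ /= nv]; rewrite /h /chain_of xgetPN ?/chain_cost /connections ?big_nil //.
  by move=> s Cs; apply: nv; exists (v, s).
Qed.

Lemma total_cost_reschedule C : feasible I C ->
  total_cost I (reschedule I @` C) = total_cost I C.
Proof.
case=> _ _ C1; rewrite /total_cost fsbig_image.
  by apply: eq_fsbigr => c _; apply/esym/chain_cost_same/reschedule_same.
(* Injectivity on [C]: [reschedule] keeps the vehicle, which determines the chain. *)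
move=> c c'; rewrite !inE => Cc Cc' [cc' _].
exact: (C1 c'.1).
Qed.

(** Vehicles, plans and positions are kept, so the unique pair [(c, i)] serving a plan becomes
    [(reschedule I c, i)]. *)
Lemma feasible_reschedule C : feasible I C -> feasible I (reschedule I @` C).
Proof.
case=> Cc Cp C1; have Cv c c' : C c -> C c' -> c.1 = c'.1 -> c = c'.
  by move=> ? ? e; apply: (C1 c'.1).
have vat c p i : C c -> variant_at I p (reschedule I c) i <-> variant_at I p c i.
  move=> /Cc pc; have pc' := plan_chain_reschedule _ _ pc.
  by rewrite !variant_at_plan //= map_fst_earliest.
split.
- by move=> _ [c /Cc pc <-]; exact: plan_chain_reschedule.
- move=> p; have [[c i] [/= [cC cp] u]] := Cp p.
  exists (reschedule I c, i); split=> /=.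
    by split; [exists c|apply/vat].
  move=> [_ j] /= [[c' c'C <-] /vat -/(_ c'C) c'p].
  by have [-> ->] := u (c', j) (conj c'C c'p).
- by move=> v _ _ [c cC <-] [c' c'C <-] /= cv c'v; rewrite (Cv c c') // cv.
Qed.

(** A plan at two positions of [c] would be served by two distinct pairs [(c, i)]. *)
Lemma uniq_plans C c : feasible I C -> C c -> uniq (map fst c.2).
Proof.
case=> Cc Cp _ cC.
case sE: (map fst c.2) => [//|p0 s']; rewrite -sE; apply/(uniqP p0).
move=> i j; rewrite !inE => ilt jlt ij.
have at_nth k : (k < size (map fst c.2))%N ->
    variant_at I (nth p0 (map fst c.2) k) c k.
  move=> klt; apply/variant_at_plan; first exact: Cc.
  by rewrite onthE (nth_map p0).
have [ci [_ u]] := Cp (nth p0 (map fst c.2) i).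
have ciE k : (k < size (map fst c.2))%N ->
   nth p0 (map fst c.2) k = nth p0 (map fst c.2) i -> ci = (c, k).
  by move=> klt ke; apply: u; split=> //=; rewrite -ke; exact: at_nth.
by have := ciE j jlt (esym ij); rewrite (ciE i) // => -[].
Qed.

Lemma optimal_exists : (exists C, feasible I C) -> exists C, optimal I C.
Proof.
case=> C0 feas0.
(* A code in a finite type. By [uniq_plans] no word is longer than [#|P|] when [C] is feasible, so
   nothing is lost to the default of [insub_bseq]. *)
pose plans C := [ffun v => insub_bseq #|P| (map fst (chain_of C v))].
pose cost (g : {ffun V -> #|P|.-bseq P}) :=
  \sum_v chain_cost I (v, [seq (p, 0) | p <- g v]).
have costE C : feasible I C -> total_cost I C = cost (plans C).
  move=> fC; have [_ _ C1] := fC.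
  rewrite total_cost_vehicles => [|c c' Cc Cc' cc']; last exact: (C1 c'.1).
  apply: eq_bigr => v _; apply: chain_cost_same; split=> //=.
  rewrite -map_comp map_id ffunE val_insubd ifT //.
  rewrite /chain_of; case: xgetP => [s _ Cs|_] //=.
  by rewrite -(card_uniqP (uniq_plans _ _ fC Cs)) max_card.
pose attained g := `[< exists C, feasible I C /\ plans C = g >].
have at0 : attained (plans C0) by apply/asboolP; exists C0.
have [g /asboolP[C [fC Cg]] gmin] := arg_minP cost at0.
exists C; split=> // C' fC'; rewrite !costE // Cg.
by apply: gmin; apply/asboolP; exists C'.
Qed.

End Cost.

(** * Variants reached by the algorithm *)

Section Algorithm.
Context {R : realType} {P V : finType} (I : instance R P V).
Implicit Types (a : element R P V) (b : P) (x : variant R P) (s : state R P V).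
Implicit Types (l : seq (element R P V * P)) (c : sequence R P V).

Lemma try_connect_generated s ab :
  generated s `<=` generated (try_connect I s ab).
Proof.
by case: ab => a b x sx; rewrite /try_connect; do 2 case: ifP => //= _; left.
Qed.

Lemma foldl_generated s l : generated s `<=` generated (foldl (try_connect I) s l).
Proof.
by elim: l s => [|ab l IH] s x sx //=; apply/IH/try_connect_generated.
Qed.

Lemma foldl_calls s l a b : (a, b) \in l ->
  0 < needed_delay I a b <= max_delay I b ->
  generated (foldl (try_connect I) s l) (b, needed_delay I a b).
Proof.
move=> + /andP[m0 mM]; elim: l s => //= ab l IH s; rewrite inE.
case/predU1P => [<-|abl]; last exact: IH.
apply: foldl_generated; rewrite /try_connect /= -/(needed_delay I a b).
by rewrite leNgt m0 mM; right.
Qed.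

(** The first-in first-out property: calls only append to the queue, and whatever they generate is
    among the appended entries. *)
Lemma foldl_queue s l : exists q,
  queue (foldl (try_connect I) s l) = queue s ++ q /\
  forall x, generated (foldl (try_connect I) s l) x ->
    generated s x \/ x \in q.
Proof.
elim: l s => [|[a b] l IH] s /=; first by exists [::]; rewrite cats0; split=> //; left.
rewrite -/(needed_delay I a b); set m := needed_delay I a b.
case: ifP => _; first exact: (IH (State _ _ _)).
case: ifP => _; last exact: IH.
have [q /= [-> qP]] := IH (State (generated s `|` [set (b, m)])
  (links s `|` [set (a, (b, m))]) (rcons (queue s) (b, m))).
exists ((b, m) :: q); rewrite cat_rcons; split=> // x /qP[[|->]|xq]; first by left.
  by right; rewrite mem_head.
by right; rewrite inE xq orbT.
Qed.

Let st n := iter n (pop_step I) (initial_state I).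

Lemma pop_step_queue s : exists q,
  queue (pop_step I s) = behead (queue s) ++ q /\
  forall x, generated (pop_step I s) x -> generated s x \/ x \in q.
Proof.
rewrite /pop_step; case sq: (queue s) => [|y q] /=.
  by exists [::]; rewrite sq; split=> // x; left.
exact: foldl_queue.
Qed.

Lemma queued_popped n x : x \in queue (st n) ->
  exists k, ohead (queue (st k)) = Some x.
Proof.
(* Induction on the position of [x] in the queue, which drops by one at each pop. *)
move=> /onthP[i]; elim: i n => [|i IH] n xi.
  by exists n; case: (queue _) xi.
apply: (IH n.+1); rewrite /st iterS; have [q [-> _]] := pop_step_queue (st n).
rewrite onth_cat; case: (queue (st n)) xi => //= y q' xi.
by rewrite -onthTE xi.
Qed.

Lemma generated_popped x : alg_variants I x ->
  exists k, ohead (queue (st k)) = Some x.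
Proof.
move=> [n _]; rewrite -/(st n); elim: n => [|n IH].
  have [q [/= sq qP]] := foldl_queue (State set0 set0 [::]) (initial_calls R P V).
  by move=> /qP[//|xq]; apply: (queued_popped 0); rewrite /st /= /initial_state sq.
rewrite /st iterS -/(st n); have [q [sq qP]] := pop_step_queue (st n).
case/qP => [/IH //|xq]; apply: (queued_popped n.+1).
by rewrite /st iterS sq mem_cat xq orbT.
Qed.

Lemma alg_variants_initial (a : P + V) b : inl b != a ->
  0 < needed_delay I (node_element R a) b <= max_delay I b ->
  alg_variants I (b, needed_delay I (node_element R a) b).
Proof.
move=> ba mb; exists 0%N => //; apply: foldl_calls => //.
apply/allpairsPdep; exists a, b; split=> //; first by rewrite mem_enum.
by rewrite mem_filter ba mem_enum.
Qed.

Lemma alg_variants_step x b : alg_variants I x -> x.1 != b ->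
  0 < needed_delay I (inl x) b <= max_delay I b ->
  alg_variants I (b, needed_delay I (inl x : element R P V) b).
Proof.
move=> /generated_popped[k kx] xb mb; exists k.+1 => //.
rewrite iterS -/(st k) /pop_step; case: (queue (st k)) kx => //= y q [->].
by apply: foldl_calls => //; apply: map_f; rewrite mem_filter xb mem_enum.
Qed.

(** The elements from which [try_connect] is eventually called: vehicles and plans initially,
    generated variants once popped. *)
Definition servable a : Prop :=
  if a is inl x then (@nondelayed R P `|` alg_variants I) x else True.

Lemma servable_step a b : servable a -> inl b != node a ->
  needed_delay I a b <= max_delay I b ->
  (@nondelayed R P `|` alg_variants I) (b, Num.max 0 (needed_delay I a b)).
Proof.
move=> sa ba mM; case: (leP (needed_delay I a b) 0) => m0; first by left.
right; have mb : 0 < needed_delay I a b <= max_delay I b by rewrite m0.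
case: a sa ba {mM m0} mb => [[p d]|v] /= sa ba mb.
- case: sa => [d0|xa]; last by apply: alg_variants_step; rewrite //= eq_sym.
  (* With delay [0] the variant is [node_element] of its plan, so an initial call covers it. *)
  by move: mb; rewrite (d0 : d = 0) => mb; apply: (alg_variants_initial (inl p)).
- exact: (alg_variants_initial (inr v)).
Qed.

(** Induction with [servable_step]: the chain condition bounds each needed delay, and distinctness
    of the plans matters because [try_connect] is never called from a variant to its own plan. *)
Lemma earliest_servable a (ps : seq P) : servable a ->
  uniq ps -> all (fun p => inl p != node a) ps ->
  chain_from I a (earliest I a ps) ->
  forall x, x \in earliest I a ps -> (@nondelayed R P `|` alg_variants I) x.
Proof.
elim: ps a => //= p ps IH a sa /andP[pps ups] /andP[pa _].
case=> /all_variantsE /= /andP[_]; rewrite ge_max => /andP[_ mM] _ pc.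
have sp := servable_step _ _ sa pa mM.
move=> x; rewrite inE => /predU1P[-> //|]; apply: IH => //=.
by apply/allP => q qps; apply: contraNneq pps => -[<-].
Qed.

End Algorithm.

Theorem theorem3p1 (R : realType) (P V : finType) (I : instance R P V)
  (cost_eq : forall c c' : sequence R P V,
     plan_chain I c -> plan_chain I c' -> same_up_to_delays c c' ->
     chain_cost I c = chain_cost I c')
  (feas : exists C0 : set (sequence R P V), feasible I C0) :
  exists C : set (sequence R P V),
    optimal I C /\
    forall c, C c -> forall x, x \in c.2 ->
      (@nondelayed R P `|` alg_variants I) x.
Proof.
have [C [fC optC]] := optimal_exists I feas.
have fC' := feasible_reschedule I C fC.
exists (reschedule I @` C); split.
  by split=> // C' /optC; rewrite total_cost_reschedule.
move=> _ [c cC <-] x; have [Cc _ _] := fC.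
apply: earliest_servable => //=; first exact: uniq_plans fC cC.
- by apply/allP.
- by apply/(plan_chainE I (reschedule I c))/plan_chain_reschedule/Cc.
Qed.
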